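(* Let $f\in\mathbb{R}[x]$, $x=(x_1,\dots,x_n)$, and let $X\subset\mathbb{R}^n$ be a compact and convex set. Let $R=\max\{|x|:x\in X\}$ and let $m\in\mathbb{R}$ be a constant such that $m\le\min\{f(x):x\in X\}$. Then for any $D>D_n(f,R)$ and any $\xi\in\mathbb{R}^n$, the function $\varphi_\xi(x):=e^{|x-\xi|^2}[f(x)-m+D]$, $x\in\mathbb{R}^n$, is strongly convex on $X$.
   Context: $|\cdot|$ is the Euclidean norm on $\mathbb{R}^n$. For a polynomial $f=\sum_{j=0}^d\sum_{|\nu|=j}a_\nu x^\nu$ with $a_\nu\in\mathbb{R}$ (where $\nu\in\mathbb{N}^n$, $0\in\mathbb{N}$, $|\nu|=\nu_1+\cdots+\nu_n$, $x^\nu=x_1^{\nu_1}\cdots x_n^{\nu_n}$) and $R>0$, $$D_n(f,R):=\max\Big\{1,\ \sum_{j=1}^d\sum_{|\nu|=j}j|a_\nu|R^{j-1},\ \sum_{j=1}^d\sum_{|\nu|=j}j(j-1)|a_\nu|R^{j-2}\Big\}.$$ A function $\varphi$ is strongly convex on a convex set $X$ if for some $\mu>0$ the function $\varphi(x)-\frac{\mu}{2}|x|^2$ is convex on $X$. *)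

(* Defs.v *)
From HB Require Import structures.
From mathcomp Require Import all_boot all_order all_algebra.
From mathcomp Require Import all_classical all_reals all_analysis.
(* The notations of mpoly clash with those of MathComp-Analysis. *)
From mathcomp Require mpoly.
Import -(notations) mpoly.

Set Implicit Arguments.
Unset Strict Implicit.
Unset Printing Implicit Defensive.

Import Order.TTheory GRing.Theory Num.Theory.
Import numFieldNormedType.Exports.

Local Open Scope classical_set_scope.
Local Open Scope ring_scope.

(* The library norm [`|x|] on ['rV[R]_n] is the sup norm; both norms induce the
   library topology of ['rV[R]_n]. *)
Definition enorm (R : realType) (n : nat) (x : 'rV[R]_n) : R :=
  Num.sqrt (\sum_(i < n) x ord0 i ^+ 2).

Definition is_max (R : realType) (A : set R) (M : R) : Prop :=
  A M /\ ubound A M.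

Definition is_min (R : realType) (A : set R) (m : R) : Prop :=
  A m /\ lbound A m.

Definition mpeval (R : realType) (n : nat) (f : mpoly n R)
    (x : 'rV[R]_n) : R :=
  meval (fun i => x ord0 i) f.

(* With d the degree of f, [msize f] is d + 1 (and 0 for f = 0), and
   [bmultinom n (msize f)] is the finite type of all multi-indices nu with
   |nu| <= d. The truncated exponent [j - 2] differs from the integer one only
   for j = 1, where the factor j (j - 1) vanishes. *)
Definition Dn (R : realType) (n : nat) (f : mpoly n R) (r : R) : R :=
  Num.max 1 (Num.max
    (\sum_(1 <= j < msize f)
       \sum_(nu : bmultinom n (msize f) | mdeg nu == j)
         j%:R * `|mcoeff nu f| * r ^+ (j - 1)%N)
    (\sum_(1 <= j < msize f)
       \sum_(nu : bmultinom n (msize f) | mdeg nu == j)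
         (j * (j - 1))%N%:R * `|mcoeff nu f| * r ^+ (j - 2)%N)).

Definition strongly_convex_on (R : realType) (n : nat) (X : set 'rV[R]_n)
    (phi : 'rV[R]_n -> R) : Prop :=
  exists2 mu : R, 0 < mu &
    convex_function X (fun x => phi x - mu / 2 * enorm x ^+ 2).

(* Main.v *)
Require Import Defs.
From HB Require Import structures.
From mathcomp Require Import all_boot all_order all_algebra.
From mathcomp Require Import all_classical all_reals all_analysis.
From mathcomp Require Import ring lra.
From mathcomp Require mpoly.
Import -(notations) mpoly.
Set Implicit Arguments.
Unset Strict Implicit.
Unset Printing Implicit Defensive.
Import Order.TTheory GRing.Theory Num.Theory.
Import numFieldNormedType.Exports.
Local Open Scope classical_set_scope.
Local Open Scope ring_scope.

(** Convexity on X only concerns the restrictions of the function to segments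
    of X, so fix a segment t |-> x + t v and write q(t) = |x + t v - xi|^2 and
    g(t) = f(x + t v) - m + D; both are polynomials in t, and q'' = 2 |v|^2.
    Then
      (e^q g)'' = e^q ((q'^2 + 2 |v|^2) g + 2 q' g' + g'').
    On X one has g >= D because f >= m there. Differentiating f monomial by
    monomial along the segment, inside the ball of radius r, produces exactly
    the two sums of [Dn] ([deriv_mpoly_line_bound]):
      |g'| <= Dn f r |v|   and   |g''| <= Dn f r |v|^2.
    As Dn f r <= D, completing the square bounds the second factor from below:
      (q'^2 + 2 |v|^2) g + 2 q' g' + g''
        >= D (|q'| - |v|)^2 + (D - Dn f r) |v|^2 >= (D - Dn f r) |v|^2
    ([quadratic_form_bound]). Since e^q >= 1, the second derivative of the
    restriction is at least mu |v|^2 with mu = D - Dn f r > 0, and mu |v|^2 is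
    the second derivative of (mu / 2) |x + t v|^2. So mu is a modulus of strong
    convexity, uniformly over all segments.

    All functions of t met on the way have the form e^q p - s with q, p, s
    univariate polynomials, a class stable under differentiation; derivatives
    are therefore formal derivatives of polynomials ([exp_poly]). *)

(** * Derivatives of a monomial along a line *)

Section jets.
Variables (R : realType) (t r c : R).

(** The bounds obeyed, with their first two derivatives, by products of j
    affine functions of size at most r and slope at most c. The truncated
    exponents are harmless, since the coefficient in front of them vanishes
    whenever truncation occurs. *)
Definition monomial_jet (j : nat) (p : {poly R}) : Prop :=
  [/\ `|p.[t]| <= r ^+ j,
      `|p^`().[t]| <= j%:R * r ^+ (j - 1) * c &
      `|p^`()^`().[t]| <= (j * (j - 1))%N%:R * r ^+ (j - 2) * c ^+ 2].

Lemma monomial_jet1 : monomial_jet 0 1.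
Proof.
by split; rewrite -[1]polyC1 ?derivC hornerC ?normr1 ?normr0 ?mul0n ?mul0r.
Qed.

(** Leibniz' rule, together with j + 1 = 1 + j for the first derivative and
    (j + 1) j = 2 j + j (j - 1) for the second. *)
Lemma monomial_jetM (j : nat) (l p : {poly R}) :
  0 <= r -> 0 <= c ->
  `|l.[t]| <= r -> `|l^`().[t]| <= c -> l^`()^`() = 0 ->
  monomial_jet j p -> monomial_jet j.+1 (l * p).
Proof.
move=> r0 c0 l0 l1 l2 [p0 p1 p2].
split.
- by rewrite hornerM normrM exprS ler_pM.
- rewrite derivM hornerD !hornerM.
  have -> : j.+1%:R * r ^+ (j.+1 - 1) * c
          = c * r ^+ j + r * (j%:R * r ^+ (j - 1) * c).
    case: j {p0 p1 p2} => [|j]; first by rewrite !mul0r mulr0 addr0 expr0; ring.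
    by rewrite !subn1 /= exprS -natr1; ring.
  by apply: (le_trans (ler_normD _ _)); rewrite !normrM lerD ?ler_pM.
- rewrite derivM derivD !derivM l2 mul0r add0r !hornerD !hornerM.
  have -> : (j.+1 * (j.+1 - 1))%N%:R * r ^+ (j.+1 - 2) * c ^+ 2
      = c * (j%:R * r ^+ (j - 1) * c) + (c * (j%:R * r ^+ (j - 1) * c)
        + r * ((j * (j - 1))%N%:R * r ^+ (j - 2) * c ^+ 2)).
    case: j {p0 p1 p2} => [|[|j]]; rewrite ?(mul0n, muln0) !subSS ?subn0 ?sub0n.
    + by ring.
    + by ring.
    + by rewrite [r ^+ j.+1]exprS !natrM -!natr1; ring.
  apply: (le_trans (ler_normD _ _)); rewrite lerD ?normrM ?ler_pM//.
  by apply: (le_trans (ler_normD _ _)); rewrite !normrM lerD ?ler_pM.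
Qed.

Lemma monomial_jet_mmap1 (n : nat) (l : 'I_n -> {poly R}) (nu : multinom n) :
  0 <= r -> 0 <= c ->
  (forall i, `|(l i).[t]| <= r) -> (forall i, `|(l i)^`().[t]| <= c) ->
  (forall i, (l i)^`()^`() = 0) ->
  monomial_jet (mdeg nu) (mmap1 l nu).
Proof.
move=> r0 c0 l0 l1 l2; rewrite mdegE /mmap1.
elim/big_rec2: _ => [|i p j _ jp]; first exact: monomial_jet1.
elim: (nu i) => [|k IH]; first by rewrite expr0 mul1r.
by rewrite exprS -mulrA addSn; apply: monomial_jetM.
Qed.
End jets.

(** * Restricting a multivariate polynomial to a line *)

(** Regroups the sum over all monomials as the double sum of [Dn], which has
    no degree 0 term. *)
Lemma sum_by_degree (R : realType) (n d : nat) (F : nat -> bmultinom n d -> R) :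
  (forall nu, F 0%N nu = 0) ->
  \sum_(nu : bmultinom n d) F (mdeg nu) nu =
  \sum_(1 <= j < d) \sum_(nu : bmultinom n d | mdeg nu == j) F j nu.
Proof.
move=> F0.
have -> : \sum_(1 <= j < d) \sum_(nu : bmultinom n d | mdeg nu == j) F j nu
        = \sum_(0 <= j < d) \sum_(nu : bmultinom n d | mdeg nu == j) F j nu.
  case: d F F0 => [|d] F F0; first by rewrite !big_geq.
  by rewrite [RHS]big_ltn// [X in X + _]big1 ?add0r.
rewrite (exchange_big_dep predT)//=; apply: eq_bigr => nu _.
under eq_bigl => j do rewrite eq_sym.
by rewrite big_nat1_eq /= bmdeg.
Qed.

Section line.
Variables (R : realType) (n : nat).
Implicit Types (x v : 'rV[R]_n) (f : mpoly n R).

Definition coord_line x v (i : 'I_n) : {poly R} :=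
  (x ord0 i)%:P + (v ord0 i) *: 'X.

Definition mpoly_line f x v : {poly R} := mmap polyC (coord_line x v) f.

Definition sqnorm_line x v : {poly R} := \sum_i coord_line x v i ^+ 2.

Lemma horner_coord_line x v i t :
  (coord_line x v i).[t] = (x + t *: v) ord0 i.
Proof. by rewrite /coord_line !hornerE !mxE mulrC. Qed.

Lemma deriv_coord_line x v i : (coord_line x v i)^`() = (v ord0 i)%:P.
Proof. by rewrite /coord_line derivD derivC derivZ derivX add0r alg_polyC. Qed.

Lemma enorm_sqr x : enorm x ^+ 2 = \sum_i x ord0 i ^+ 2.
Proof. by rewrite /enorm sqr_sqrtr// sumr_ge0// => i _; exact: sqr_ge0. Qed.

Lemma enorm_ge0 x : 0 <= enorm x. Proof. exact: sqrtr_ge0. Qed.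

Lemma coord_le_enorm x i : `|x ord0 i| <= enorm x.
Proof.
rewrite -(@ler_pXn2r _ 2)// ?nnegrE// ?enorm_ge0// enorm_sqr real_normK ?num_real//.
by rewrite (bigD1 i)//= lerDl sumr_ge0// => k _; exact: sqr_ge0.
Qed.

Lemma horner_mpoly_line f x v t : (mpoly_line f x v).[t] = mpeval f (x + t *: v).
Proof.
rewrite /mpoly_line /mpeval /meval /mmap horner_sum; apply: eq_bigr => nu _.
rewrite hornerM hornerC; congr (_ * _); rewrite /mmap1 horner_prod.
by apply: eq_bigr => i _; rewrite horner_exp horner_coord_line.
Qed.

Lemma horner_sqnorm_line x v t : (sqnorm_line x v).[t] = enorm (x + t *: v) ^+ 2.
Proof.
rewrite enorm_sqr horner_sum; apply: eq_bigr => i _.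
by rewrite horner_exp horner_coord_line.
Qed.

Lemma deriv2_sqnorm_line x v :
  (sqnorm_line x v)^`()^`() = (2 * enorm v ^+ 2)%:P.
Proof.
rewrite enorm_sqr mulr_sumr rmorph_sum /= /sqnorm_line 2!raddf_sum /=.
apply: eq_bigr => i _.
rewrite deriv_exp /= derivMn derivM !deriv_coord_line derivC mul0r add0r.
by rewrite -polyCM -polyCMn; congr _%:P; ring.
Qed.

(** Each coordinate of the line is an affine function bounded by r with slope
    at most |v|, so [monomial_jet] bounds every monomial of f; the weighted
    sums of these bounds are the two sums in the definition of [Dn]. *)
Lemma deriv_mpoly_line_bound f x v t r :
  enorm (x + t *: v) <= r ->
  `|(mpoly_line f x v)^`().[t]| <= Dn f r * enorm v /\
  `|(mpoly_line f x v)^`()^`().[t]| <= Dn f r * enorm v ^+ 2.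
Proof.
move=> xr; have r0 : 0 <= r := le_trans (enorm_ge0 _) xr.
have jet (nu : multinom n) :
    monomial_jet t r (enorm v) (mdeg nu) (mmap1 (coord_line x v) nu).
  apply: monomial_jet_mmap1 => // [|i|i|i]; first exact: enorm_ge0.
  - by rewrite horner_coord_line (le_trans (coord_le_enorm _ _)).
  - by rewrite deriv_coord_line hornerC coord_le_enorm.
  - by rewrite deriv_coord_line derivC.
rewrite /mpoly_line (mmapE (msize f))//.
split; rewrite !raddf_sum /= horner_sum; apply: (le_trans (ler_norm_sum _ _ _)).
- apply: (@le_trans _ _ ((\sum_(1 <= j < msize f)
     \sum_(nu : bmultinom n (msize f) | mdeg nu == j)
        j%:R * `|mcoeff nu f| * r ^+ (j - 1)%N) * enorm v)); last first.
    by apply: ler_wpM2r; rewrite ?enorm_ge0// /Dn !le_max lexx !orbT.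
  rewrite -(sum_by_degree (F := fun j nu => j%:R * `|mcoeff nu f| * r ^+ (j - 1))).
    rewrite mulr_suml; apply: ler_sum => nu _; have [_ H _] := jet nu.
    rewrite derivM derivC mul0r add0r hornerM hornerC normrM.
    by rewrite [X in X * _ * _]mulrC -!mulrA ler_wpM2l// mulrA.
  by move=> nu; rewrite !mul0r.
- apply: (@le_trans _ _ ((\sum_(1 <= j < msize f)
     \sum_(nu : bmultinom n (msize f) | mdeg nu == j)
        (j * (j - 1))%N%:R * `|mcoeff nu f| * r ^+ (j - 2)%N) * enorm v ^+ 2)); last first.
    by apply: ler_wpM2r; rewrite ?exprn_ge0 ?enorm_ge0// /Dn !le_max lexx !orbT.
  rewrite -(sum_by_degree
    (F := fun j nu => (j * (j - 1))%N%:R * `|mcoeff nu f| * r ^+ (j - 2))).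
    rewrite mulr_suml; apply: ler_sum => nu _; have [_ _ H] := jet nu.
    rewrite derivM derivC mul0r add0r derivM derivC mul0r add0r.
    rewrite hornerM hornerC normrM.
    by rewrite [X in X * _ * _]mulrC -!mulrA ler_wpM2l// mulrA.
  by move=> nu; rewrite !mul0r.
Qed.
End line.

(** * Convexity of exponential polynomials *)

Section exp_poly.
Variable R : realType.
Implicit Types p q s : {poly R}.

Definition exp_poly q p s : R -> R^o := fun t => expR q.[t] * p.[t] - s.[t].

Lemma is_derive_exp_poly q p s (t : R) :
  is_derive t (1 : R) (exp_poly q p s) (exp_poly q (q^`() * p + p^`()) s^`() t).
Proof.
have dE := is_derive1_comp (is_derive_expR q.[t]) (is_derive_poly q t).
have dEp := is_deriveM dE (is_derive_poly p t).
apply: (trigger_derive (is_deriveB dEp (is_derive_poly s t))).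
by rewrite /exp_poly !hornerE /GRing.scale /=; ring.
Qed.

(** The second derivative is [exp_poly] of the polynomials obtained by applying
    [is_derive_exp_poly] twice. In a convex combination [x <| t |> y] the weight
    t goes to x, hence the parameter 1 - t on the segment from x to y. *)
Lemma exp_poly_convex q p s (t : {i01 R}) :
  (forall u : R, 0 < u < 1 -> 0 <= exp_poly q
     (q^`() * (q^`() * p + p^`()) + (q^`() * p + p^`())^`()) s^`()^`() u) ->
  exp_poly q p s (1 - t%:num) <=
  t%:num * exp_poly q p s 0 + (1 - t%:num) * exp_poly q p s 1.
Proof.
move=> pos.
have D1 : 'D_1 (exp_poly q p s : R -> R^o) = exp_poly q (q^`() * p + p^`()) s^`().
  by apply/funext => u; apply: derive_val; exact: is_derive_exp_poly.
have dP p' s' (a : R) : derivable (exp_poly q p' s') a 1.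
  by case: (is_derive_exp_poly q p' s' a).
have cont a : exp_poly q p s x @[x --> a] --> exp_poly q p s a.
  apply/differentiable_continuous/derivable1_diffP.
  exact: dP.
have := @second_derivative_convex R (exp_poly q p s) 0 1 _ _ _ _ _ t ler01.
rewrite !convRE mulr0 add0r mulr1; apply.
- move=> u u01; rewrite D1.
  by rewrite (@derive_val _ _ _ _ _ _ _ (is_derive_exp_poly _ _ _ _)); exact: pos.
- exact/cvg_at_left_filter/cont.
- exact/cvg_at_right_filter/cont.
- by move=> u _; exact: dP.
- by move=> u _; rewrite D1; exact: dP.
Qed.
End exp_poly.

(** * Strong convexity *)

(** The difference of the two sides is at least D (|q1| - c)^2: the cross term
    satisfies 2 |q1 g1| <= 2 |q1| D c because B <= D, and one of the two copies
    of c^2 g >= c^2 D completes the square while the other absorbs |g2|. *)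
Lemma quadratic_form_bound (R : realFieldType) (D B c g g1 g2 q1 : R) :
  0 <= c -> 0 <= D -> B <= D -> D <= g -> `|g1| <= B * c -> `|g2| <= B * c ^+ 2 ->
  (D - B) * c ^+ 2 <= (q1 ^+ 2 + 2 * c ^+ 2) * g + 2 * q1 * g1 + g2.
Proof.
move=> c0 D_ge0 BD Dg G1 G2.
have K0 : 0 <= q1 ^+ 2 + 2 * c ^+ 2.
  by rewrite addr_ge0 ?sqr_ge0// mulr_ge0 ?sqr_ge0.
have H1 := ler_wpM2l K0 Dg.
have H2 : `|q1 * g1| <= `|q1| * (D * c).
  by rewrite normrM ler_wpM2l// (le_trans G1)// ler_wpM2r.
have H3 : 0 <= D * (`|q1| - c) ^+ 2 by rewrite mulr_ge0// sqr_ge0.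
have H4 : D * (`|q1| - c) ^+ 2
        = D * q1 ^+ 2 - 2 * (`|q1| * (D * c)) + D * c ^+ 2.
  by rewrite sqrrB real_normK ?num_real//; ring.
move: H2 G2; rewrite !ler_norml => /andP[H2 _] /andP[G2 _].
rewrite H4 in H3; lra.
Qed.

Theorem corollary4 (R : realType) (n : nat) (f : mpoly n R)
    (X : set 'rV[R]_n) (Xcompact : compact X) (Xconvex : convex_set X)
    (r : R) (r_max : is_max [set enorm x | x in X] r)
    (fmin : R) (fmin_min : is_min [set mpeval f x | x in X] fmin)
    (m : R) (m_le : m <= fmin)
    (D : R) (D_gt : Dn f r < D) (xi : 'rV[R]_n) :
  strongly_convex_on X
    (fun x : 'rV[R]_n => expR (enorm (x - xi) ^+ 2) * (mpeval f x - m + D)).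
Proof.
have [_ Xr] := r_max.
have [_ fge] := fmin_min.
have D_ge0 : 0 <= D.
  by rewrite (le_trans _ (ltW D_gt))// /Dn le_max ler01.
exists (D - Dn f r); first by rewrite subr_gt0.
move=> t x y xX yX; set mu := D - Dn f r.
pose v := y - x.
pose q := sqnorm_line (x - xi) v.
pose p := mpoly_line f x v + (D - m)%:P.
pose s := (mu / 2) *: sqnorm_line x v.
have E u : exp_poly q p s u = expR (enorm ((x + u *: v) - xi) ^+ 2) *
    (mpeval f (x + u *: v) - m + D) - mu / 2 * enorm (x + u *: v) ^+ 2.
  rewrite /exp_poly /q /p /s hornerZ hornerD hornerC !horner_sqnorm_line.
  by rewrite horner_mpoly_line addrAC -(addrA (mpeval _ _)) [- m + D]addrC.
have conv u : x + (1 - u) *: v = u *: x + (1 - u) *: y.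
  by apply/rowP => i; rewrite !mxE; ring.
have := @exp_poly_convex R q p s t.
rewrite !E scale0r addr0 scale1r conv.
have -> : x + v = y by rewrite /v addrC subrK.
apply=> u /andP[u0 u1].
have Xu : X (x + u *: v).
  have u01 : 0 <= 1 - u <= 1 by lra.
  have := Xconvex x y (Itv01 (proj1 (andP u01)) (proj2 (andP u01))) xX yX.
  rewrite inE /= -[u in X (x + u *: v)](subKr 1) conv; exact: id.
have [B1 B2] := deriv_mpoly_line_bound f (Xr _ (imageP _ Xu)).
have pD : D <= p.[u].
  rewrite /p hornerD hornerC horner_mpoly_line.
  have := fge _ (imageP (mpeval f) Xu); lra.
have q2 : q^`()^`() = (2 * enorm v ^+ 2)%:P by exact: deriv2_sqnorm_line.
have p1 : p^`() = (mpoly_line f x v)^`() by rewrite derivD derivC addr0.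
have s2 : s^`()^`() = (mu * enorm v ^+ 2)%:P.
  rewrite !derivZ deriv2_sqnorm_line -mul_polyC -polyCM; congr _%:P; lra.
have E1 : 1 <= expR q.[u].
  by rewrite -expR0 ler_expR horner_sqnorm_line sqr_ge0.
(* Forgetting how p, q and s are built keeps the derivation rules below from
   unfolding them. *)
clear E; clearbody p q s.
rewrite /exp_poly s2 derivD derivM q2 p1 !(hornerD, hornerM, hornerC) subr_ge0.
have := quadratic_form_bound q^`().[u] (enorm_ge0 v) D_ge0 (ltW D_gt) pD B1 B2.
set lo := (D - Dn f r) * _; set hi := _ + _ => lohi.
have lo0 : 0 <= lo by rewrite mulr_ge0 ?sqr_ge0// subr_ge0 ltW.
apply: (le_trans lohi).
rewrite [X in _ <= _ * X](_ : _ = hi); last by rewrite /hi; ring.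
by rewrite ler_peMl// (le_trans lo0).
Qed.
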